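(* Let $t \geq 5$ be an integer and let $G$ be a connected graph on $n$ vertices satisfying $\sigma_2(G) \geq \frac{t-3}{t-2}n$. If $G$ has no Hamiltonian path, then $n \geq 2t-4$, and moreover: (1) if $n > 2t-4$, then $G$ has an induced subgraph isomorphic to $K_{1,t}$; (2) if $n = 2t-4$, then $G$ is of the form $H \vee \overline{K}_{t-1}$ where $H$ is a graph on $t-3$ vertices.
   Context: All graphs are finite and simple. A Hamiltonian path of $G$ is a path containing all vertices of $G$. For a graph $G$, $\sigma_2(G)$ denotes the minimum of $\deg(x)+\deg(y)$ over all pairs of distinct nonadjacent vertices $x,y$ of $G$. $K_{1,t}$ denotes the star with one center vertex adjacent to $t$ pairwise nonadjacent leaves. $G \vee H$ denotes the join of graphs $G$ and $H$ (disjoint union plus all edges between $V(G)$ and $V(H)$), and $\overline{K}_{t-1}$ denotes the edgeless graph on $t-1$ vertices. *)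

(* Defs.v *)
From mathcomp Require Import all_boot.
Set Implicit Arguments. Unset Strict Implicit. Unset Printing Implicit Defensive.

Definition simple_graph (T : finType) (e : rel T) : Prop :=
  symmetric e /\ irreflexive e.

Definition deg (T : finType) (e : rel T) (x : T) : nat := #|[set y | e x y]|.

Definition connected (T : finType) (e : rel T) : Prop :=
  forall x y : T, connect e x y.

Definition walk_seq (T : finType) (e : rel T) (s : seq T) : bool :=
  if s is x :: s' then path e x s' else true.

Definition hamiltonian_path (T : finType) (e : rel T) (s : seq T) : Prop :=
  [/\ uniq s, walk_seq e s & forall x : T, x \in s].

(* sigma_2(G) >= a/b, written multiplied out: for all distinct nonadjacent
   x,y,  a <= b * (deg x + deg y). Vacuous if G is complete. *)
Definition sigma2_ge (T : finType) (e : rel T) (a b : nat) : Prop :=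
  forall x y : T, x != y -> ~~ e x y -> a <= b * (deg e x + deg e y).

Definition star_rel (t : nat) : rel 'I_t.+1 :=
  fun i j => (i != j) && ((i == ord0) || (j == ord0)).

Definition has_induced (U T : finType) (f : rel U) (e : rel T) : Prop :=
  exists phi : U -> T, injective phi /\ forall u v, e (phi u) (phi v) = f u v.

Definition join_empty (U V : finType) (h : rel U) : rel (U + V) :=
  fun a b => match a, b with
             | inl u, inl u' => h u u'
             | inl _, inr _ => true
             | inr _, inl _ => true
             | inr _, inr _ => false
             end.

Definition isomorphic (U T : finType) (f : rel U) (e : rel T) : Prop :=
  exists phi : U -> T, bijective phi /\ forall u v, e (phi u) (phi v) = f u v.

(* Main.v *)
(** Let [n] be the order of [G], [m = t - 2] and [d = n %/ m], so that [3 d <= n]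
    and nonadjacent vertices have degree sum at least [n - d]. Let [P] be a
    longest path, [y] a vertex off [P] with [k] neighbours on [P], and [U] the
    first vertex of [P] together with the successors of the neighbours of [y]:
    [U] plus [y] is independent of size [k + 2].

    Call [u] in [U] swappable if some path has the vertices of [P] with [u]
    replaced by [y]. If every swappable [u] had a neighbour off [P], then the
    two neighbourhoods of a pair in [U], shifted against each other along [P],
    would leave too few edges of [P] for the degree condition, while the gaps
    between neighbours of [y] would make [P] too long; so one can swap to a
    vertex all of whose neighbours lie on the path. Swapping as long as the
    degree grows yields [y] with [N(y)] inside [P] and [2 k >= n - d].

    The degrees of [U] now concentrate on the [n - k - 2] vertices outside
    [U + y], and if none of these has [t] neighbours in [U + y] then
    [n <= 2 m]. For [n = 2 m] all inequalities are tight and [U + y] is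
    completely joined to its complement. *)
Require Import Defs.
From mathcomp Require Import all_boot zify.
Set Implicit Arguments. Unset Strict Implicit. Unset Printing Implicit Defensive.

(* [lia] is slow on boolean hypotheses outside arithmetic. *)
Ltac nlia := repeat match goal with
  | H : is_true ?b |- _ =>
      lazymatch b with leq _ _ => fail | eq_op _ _ => fail
      | negb (eq_op _ _) => fail | _ => clear H end
  | H : _ = false |- _ => clear H
  end; lia.

(** * Half-open segments of a sequence *)

Definition slice (T : Type) (s : seq T) (i j : nat) : seq T :=
  take (j - i) (drop i s).

Lemma slice_cat (T : Type) (s : seq T) (i j l : nat) :
  i <= j -> j <= l -> slice s i j ++ slice s j l = slice s i l.
Proof.
move=> ij jl; rewrite /slice.
have -> : l - i = (j - i) + (l - j) by nlia.
by rewrite takeD drop_drop subnK.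
Qed.

Lemma count_slice (T : Type) (f : pred T) (s : seq T) (i j l : nat) :
  i <= j -> j <= l ->
  count f (slice s i l) = count f (slice s i j) + count f (slice s j l).
Proof. by move=> ij jl; rewrite -count_cat slice_cat. Qed.

Lemma slice0_size (T : Type) (s : seq T) : slice s 0 (size s) = s.
Proof. by rewrite /slice drop0 subn0 take_size. Qed.

Lemma slice_nil (T : Type) (s : seq T) (i : nat) : slice s i i = [::].
Proof. by rewrite /slice subnn take0. Qed.

Lemma slice_cons (T : Type) (x0 : T) (s : seq T) (i j : nat) :
  i < j -> i < size s -> slice s i j = nth x0 s i :: slice s i.+1 j.
Proof.
move=> ij isz; rewrite /slice (drop_nth x0) //.
by have -> : j - i = (j - i.+1).+1 by nlia.
Qed.

Lemma last_slice (T : Type) (x0 x : T) (s : seq T) (i j : nat) :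
  i < j -> j <= size s -> last x (slice s i j) = nth x0 s j.-1.
Proof.
move=> ij js; rewrite -(@slice_cat _ s i j.-1 j); [|nlia|nlia].
rewrite (@slice_cons _ x0 s j.-1); [|nlia|nlia].
by rewrite prednK ?slice_nil ?last_cat //; nlia.
Qed.

(* The type of [f] is the [finType] itself, which keeps the counts in a goal
   syntactically equal for [lia]. *)
Lemma perm_count (T : finType) (s1 s2 : seq T) :
  (forall f : pred T, count f s1 = count f s2) -> perm_eq s1 s2.
Proof. by move=> eqc; apply/permP. Qed.

(** * Concatenating, reversing and splicing walks *)

Section Surgery.
Variables (T : finType) (e : rel T).
Hypothesis esym : symmetric e.

(** A nonempty walk given with both ends, so that concatenation only asks for the joining edge. *)
Definition trail (x : T) (s : seq T) (z : T) : Prop :=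
  exists s', [/\ s = x :: s', path e x s' & last x s' = z].

Lemma trail1 x : trail x [:: x] x.
Proof. by exists [::]. Qed.

Lemma trail_cat x s z x' s' z' :
  trail x s z -> e z x' -> trail x' s' z' -> trail x (s ++ s') z'.
Proof.
case=> [r [-> rp rl]] ezx [r' [-> rp' rl']]; exists (r ++ x' :: r'); split=> //.
  by rewrite cat_path rp rl /= ezx.
by rewrite last_cat.
Qed.

Lemma trail_rev x s z : trail x s z -> trail z (rev s) x.
Proof.
case=> r [-> rp rl]; exists (rev (belast x r)); split.
- by rewrite lastI rl rev_rcons.
- rewrite -[z]rl rev_path; apply: sub_path rp => u v /=; by rewrite esym.
- by case: r {rp} rl => //= u r _; rewrite rev_cons last_rcons.
Qed.

Lemma trail_slice (x0 : T) s i j :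
  sorted e s -> i < j -> j <= size s ->
  trail (nth x0 s i) (slice s i j) (nth x0 s j.-1).
Proof.
move=> ss ij js; exists (slice s i.+1 j); split.
- by apply: slice_cons; nlia.
- have : sorted e (slice s i j).
    by apply: take_sorted; apply: drop_sorted.
  by rewrite (slice_cons x0) //; nlia.
- have := @last_slice _ x0 (nth x0 s i) s i j ij js.
  by rewrite (slice_cons x0) //; nlia.
Qed.

(** Common form of the reroutings below: a prefix and a suffix of [P] are kept and [s] is put
    between them. The guarded adjacencies allow either kept piece to be empty. *)
Lemma sorted_splice (x0 : T) P a m x s z :
  sorted e P -> a <= size P -> m <= size P -> trail x s z ->
  (0 < a -> e (nth x0 P a.-1) x) -> (m < size P -> e z (nth x0 P m)) ->
  sorted e (slice P 0 a ++ s ++ slice P m (size P)).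
Proof.
move=> sP aP mP tr ea em.
have [z' tr2] : exists z', trail x (s ++ slice P m (size P)) z'.
  have [mlt|mge] := ltnP m (size P).
    exists (nth x0 P (size P).-1); apply: (trail_cat tr (em mlt)).
    exact: trail_slice.
  have -> : m = size P by nlia.
  by exists z; rewrite slice_nil cats0.
case: (posnP a) => [->|a0].
  by rewrite slice_nil /=; case: tr2 => r [-> ].
have t1 := @trail_slice x0 P 0 a sP a0 aP.
by case: (trail_cat t1 (ea a0) tr2) => r [-> ].
Qed.

End Surgery.

(** * Reroutings of a longest path through an outside vertex *)

Definition longest (T : finType) (e : rel T) (P : seq T) : Prop :=
  [/\ uniq P, sorted e P &
      forall s : seq T, uniq s -> sorted e s -> size s <= size P].


(** Indices at which [y] may follow the prefix of [P] ending before [c]: these are [0] and the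
    successors of neighbours of [y]. *)
Definition insertable (T : finType) (e : rel T) (P : seq T) (y : T) : pred nat :=
  fun c => (c < size P) && ((0 < c) ==> e (nth y P c.-1) y).

(** Three explicit situations in which [y] can replace the vertex at an insertable [c]. The default
    value [y] of [nth] is reached only at [c.+1 = size P], where the first disjunct already
    holds. *)
Definition swappable (T : finType) (e : rel T) (P : seq T) (y : T) : pred nat :=
  fun c => [|| c.+1 == size P, e y (nth y P c.+1) |
    [exists d : 'I_(size P), [&& insertable e P y d, d != c :> nat
                               & e (nth y P c.+1) (nth y P d)]]].

Section LongestPath.
Variables (T : finType) (e : rel T).
Hypotheses (esym : symmetric e) (eirr : irreflexive e).
Variables (P : seq T) (y : T).
Hypotheses (lgP : longest e P) (yP : y \notin P).

Local Notation p := (size P).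
Local Notation q := (nth y P).
Local Notation ins := (insertable e P y).

Let uP : uniq P. Proof. by case: lgP. Qed.
Let sP : sorted e P. Proof. by case: lgP. Qed.

Lemma longest_max (s : seq T) : uniq s -> sorted e s -> size s <= p.
Proof. by case: lgP => _ _; apply. Qed.

Lemma longest_no_extension (s r : seq T) :
  perm_eq s (r ++ P) -> uniq (r ++ P) -> 0 < size r -> sorted e s -> False.
Proof.
move=> ps us r0 ss; have := longest_max _ ss; rewrite (perm_uniq ps) => /(_ us).
by rewrite (perm_size ps) size_cat -[X in _ <= X]add0n leq_add2r leqNgt r0.
Qed.

Lemma longest_no_insertion (s : seq T) : perm_eq s (y :: P) -> sorted e s -> False.
Proof.
by move=> ps; apply: (@longest_no_extension s [:: y]) => //=; rewrite yP uP.
Qed.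

Lemma insertable_lt c : ins c -> c < p.
Proof. by case/andP. Qed.

Lemma insertable_pred c : ins c -> 0 < c -> e (q c.-1) y.
Proof. by case/andP=> _ /implyP. Qed.

Lemma insertable_pred_sym c : ins c -> 0 < c -> e y (q c.-1).
Proof. by rewrite esym; apply: insertable_pred. Qed.

Lemma insertable0 : 0 < p -> ins 0.
Proof. by rewrite /insertable /= => ->. Qed.

Local Notation sl := (slice P).

Let cntP (f : pred T) : count f P = count f (sl 0 p).
Proof. by rewrite slice0_size. Qed.

Let trs i j : i < j -> j <= p -> trail e (q i) (sl i j) (q j.-1).
Proof. by move=> *; apply: trail_slice. Qed.

Let trr i j : i < j -> j <= p -> trail e (q j.-1) (rev (sl i j)) (q i).
Proof. by move=> *; apply: trail_rev => //; apply: trs. Qed.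

(** Write [P[i,j)] for a segment. An edge [q a], [q b] would give the longer path [P[0,a)], [y],
    reversed [P[a,b)], [P[b,p)]. *)
Lemma insertable_nonadj a b : a < b -> ins a -> ins b -> e (q a) (q b) = false.
Proof.
move=> ab ia ib; apply/negP => eab; have bp := insertable_lt ib.
apply: (@longest_no_insertion (sl 0 a ++ ([:: y] ++ rev (sl a b)) ++ sl b p)).
  apply: perm_count => f; rewrite !(count_cat, count_rev) /= cntP.
  by rewrite (@count_slice _ f P 0 a p) 1?(@count_slice _ f P a b p); nlia.
apply: (@sorted_splice _ _ y _ _ _ y _ (q a)) => //; try nlia.
- apply: trail_cat (trail1 _ y) _ (trr _ _); try nlia.
  by apply: insertable_pred_sym => //; nlia.
- exact: insertable_pred.
Qed.

(** Otherwise [P[0,a)], [y], reversed [P[a,b)], [z], [P[b,p)] is a path with two more vertices. *)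
Lemma outside_insertable_nonadj z a b :
  z \notin P -> z != y -> a < b -> ins a -> ins b ->
  e z (q a) && e z (q b) = false.
Proof.
move=> zP zy ab ia ib; apply/negP => /andP[ea eb]; have bp := insertable_lt ib.
apply: (@longest_no_extension
          (sl 0 a ++ (([:: y] ++ rev (sl a b)) ++ [:: z]) ++ sl b p) [:: y; z]) => //.
- apply: perm_count => f; rewrite !(count_cat, count_rev) /= cntP.
  by rewrite (@count_slice _ f P 0 a p) 1?(@count_slice _ f P a b p) /=; nlia.
- by rewrite /= inE negb_or eq_sym zy yP zP uP.
apply: (@sorted_splice _ _ y _ _ _ y _ z) => //; try nlia.
- apply: trail_cat (trail_cat (trail1 _ y) _ (trr ab _)) _ (trail1 _ z); try nlia.
    by apply: insertable_pred_sym => //; nlia.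
  by rewrite esym.
- exact: insertable_pred.
Qed.

Lemma outside_trail_nonadj R z a :
  trail e y R z -> uniq (R ++ P) -> ins a -> e z (q a) = false.
Proof.
move=> tR uR ia; apply/negP => ez; have ap := insertable_lt ia.
apply: (@longest_no_extension (sl 0 a ++ R ++ sl a p) R) => //.
- apply: perm_count => f; rewrite !count_cat cntP.
  by rewrite (@count_slice _ f P 0 a p); nlia.
- by case: tR => r [->].
apply: (@sorted_splice _ _ y _ _ _ y _ z) => //; try nlia.
exact: insertable_pred.
Qed.

(** Both edges together would give [P[0,a)], [y], reversed [P[j+1,b)], [P[a,j+1)], [P[b,p)]. *)
Lemma crossing_between a b j :
  a <= j -> j.+1 < b -> ins a -> ins b ->
  e (q j) (q b) && e (q j.+1) (q a) = false.
Proof.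
move=> aj jb ia ib; apply/negP => /andP[ejb eja]; have bp := insertable_lt ib.
apply: (@longest_no_insertion
          (sl 0 a ++ (([:: y] ++ rev (sl j.+1 b)) ++ sl a j.+1) ++ sl b p)).
  apply: perm_count => f; rewrite !(count_cat, count_rev) /= cntP.
  rewrite (@count_slice _ f P 0 a p) 1?(@count_slice _ f P a b p) ?(@count_slice _ f P a j.+1 b); nlia.
apply: (@sorted_splice _ _ y _ _ _ y _ (q j)) => //; try nlia.
- apply: trail_cat (trail_cat (trail1 _ y) _ (trr jb _)) eja (@trs a j.+1 _ _); try nlia.
  by apply: insertable_pred_sym => //; nlia.
- exact: insertable_pred.
Qed.

(** The longer path is [P[0,a)], [y], reversed [P[a,b)], reversed [P[b,j+1)], [P[j+1,p)]. For [j]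
    the last index the final piece is empty and a single edge suffices. *)
Lemma crossing_right a b j :
  a < b -> b <= j -> j < p -> ins a -> ins b ->
  e (q j) (q a) -> (j.+1 < p -> e (q j.+1) (q b)) -> False.
Proof.
move=> ab bj jp ia ib eja ejb.
apply: (@longest_no_insertion
          (sl 0 a ++ (([:: y] ++ rev (sl a b)) ++ rev (sl b j.+1)) ++ sl j.+1 p)).
  apply: perm_count => f; rewrite !(count_cat, count_rev) /= cntP.
  rewrite (@count_slice _ f P 0 a p) 1?(@count_slice _ f P a b p) ?(@count_slice _ f P b j.+1 p); nlia.
apply: (@sorted_splice _ _ y _ _ _ y _ (q b)) => //; try nlia.
- have t2 := @trr b j.+1 bj jp.
  apply: trail_cat (trail_cat (trail1 _ y) _ (trr ab _)) _ t2; try nlia.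
    by apply: insertable_pred_sym => //; nlia.
  by rewrite esym.
- exact: insertable_pred.
- by move=> jp'; rewrite esym ejb.
Qed.

(** Both edges together would give [P[0,j+1)], [P[a,b)], [y], reversed [P[j+1,a)], [P[b,p)]. *)
Lemma crossing_left a b j :
  j.+1 < a -> a < b -> ins a -> ins b ->
  e (q j) (q a) && e (q j.+1) (q b) = false.
Proof.
move=> ja ab ia ib; apply/negP => /andP[eja ejb]; have bp := insertable_lt ib.
apply: (@longest_no_insertion
          (sl 0 j.+1 ++ ((sl a b ++ [:: y]) ++ rev (sl j.+1 a)) ++ sl b p)).
  apply: perm_count => f; rewrite !(count_cat, count_rev) /= cntP.
  rewrite (@count_slice _ f P 0 j.+1 p) 1?(@count_slice _ f P j.+1 b p) ?(@count_slice _ f P j.+1 a b); nlia.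
apply: (@sorted_splice _ _ y _ _ _ (q a) _ (q j.+1)) => //; try nlia.
apply: trail_cat (trail_cat (trs ab _) _ (trail1 _ y)) _ (trr ja _); try nlia.
  by apply: insertable_pred => //; nlia.
by apply: insertable_pred_sym => //; nlia.
Qed.

(** In the first two situations [y] takes the place of [q c] directly. In the third the segment
    between [c] and [d] is reversed: the path enters it from [y] and leaves it by the edge between
    [q c.+1] and [q d]. *)
Lemma swappable_path c : ins c -> swappable e P y c ->
  exists2 P', sorted e P' & perm_eq (q c :: P') (y :: P).
Proof.
move=> ic sc; have cp := insertable_lt ic.
have qc : sl c c.+1 = [:: q c] by rewrite (slice_cons y) ?slice_nil.
have cqc (f : pred T) : count f (sl c c.+1) = f (q c) by rewrite qc /= addn0.
have skip : (c.+1 < p -> e y (q c.+1)) ->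
    exists2 P', sorted e P' & perm_eq (q c :: P') (y :: P).
  move=> ey; exists (sl 0 c ++ [:: y] ++ sl c.+1 p).
    apply: (@sorted_splice _ _ y _ _ _ y _ y) => //; try nlia; first exact: trail1.
    exact: insertable_pred.
  apply: perm_count => f; rewrite /= !(count_cat, count_rev) /= ?(count_cat, count_rev) cntP -cqc.
  rewrite (@count_slice _ f P 0 c p) 1?(@count_slice _ f P c c.+1 p); nlia.
case/or3P: sc => [/eqP cl|ey|/existsP[d /and3P[id dc ecd]]].
- by apply: skip => ?; nlia.
- exact: skip.
have [cd|dc'|] := ltngtP c d; last by move=> cd; rewrite cd eqxx in dc.
- have dp := insertable_lt id.
  (* The edge is not a loop, so the segment to be reversed is nonempty. *)
  have cd' : c.+1 < d.
    rewrite ltn_neqAle cd andbT; apply: contraL ecd => /eqP ->.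
    by rewrite eirr.
  exists (sl 0 c ++ ([:: y] ++ rev (sl c.+1 d)) ++ sl d p).
    apply: (@sorted_splice _ _ y _ _ _ y _ (q c.+1)) => //; try nlia.
      apply: trail_cat (trail1 _ y) _ (trr cd' _); try nlia.
      by apply: insertable_pred_sym => //; nlia.
    exact: insertable_pred.
  apply: perm_count => f; rewrite /= !(count_cat, count_rev) /= ?(count_cat, count_rev) cntP -cqc.
  rewrite (@count_slice _ f P 0 c p) 1?(@count_slice _ f P c c.+1 p) ?(@count_slice _ f P c.+1 d p); nlia.
exists (sl 0 d ++ ([:: y] ++ rev (sl d c)) ++ sl c.+1 p).
  apply: (@sorted_splice _ _ y _ _ _ y _ (q d)) => //; try nlia.
  - apply: trail_cat (trail1 _ y) _ (trr dc' _); try nlia.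
    by apply: insertable_pred_sym => //; nlia.
  - exact: insertable_pred.
  - by rewrite esym.
apply: perm_count => f; rewrite /= !(count_cat, count_rev) /= ?(count_cat, count_rev) cntP -cqc.
rewrite (@count_slice _ f P 0 d p) 1?(@count_slice _ f P d c p) ?(@count_slice _ f P c c.+1 p); nlia.
Qed.


(** The reverse of [R] can replace everything before [q i], and [R] everything after it; neither
    change may lengthen [P]. *)
Lemma outside_trail_ends R z i :
  trail e y R z -> uniq (R ++ P) -> i < p -> e y (q i) ->
  size R <= i /\ i.+1 + size R <= p.
Proof.
move=> tR uR ip ei.
have [uR1 dR _] : [/\ uniq R, ~~ has [in R] P & uniq P].
  by apply/and3P; rewrite -cat_uniq.
have dis (s : seq T) : {subset s <= P} -> uniq s -> uniq (R ++ s).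
  move=> sub us; rewrite cat_uniq uR1 us andbT /=.
  by apply: contra dR => /hasP[x /sub xP xR]; apply/hasP; exists x.
split.
  have : sorted e (slice P 0 0 ++ rev R ++ slice P i p).
    apply: (@sorted_splice _ _ y _ _ _ z _ y) => //; try nlia.
    exact: trail_rev.
  rewrite slice_nil /= => srt.
  have := longest_max _ srt.
  rewrite (perm_uniq (_ : perm_eq _ (R ++ slice P i p))); last by rewrite perm_cat2r perm_rev.
  rewrite dis; last 2 first.
  - by move=> x xs; apply: (mem_drop (mem_take xs)).
  - by apply: take_uniq; apply: drop_uniq.
  rewrite size_cat size_rev /slice size_take size_drop => /(_ isT).
  by rewrite ltnn; nlia.
have : sorted e (slice P 0 i.+1 ++ R ++ slice P p p).
  apply: (@sorted_splice _ _ y _ _ _ y _ z) => //; try nlia.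
  by rewrite /= esym.
rewrite slice_nil cats0 => srt.
have := longest_max _ srt.
rewrite uniq_catC dis; last 2 first.
- by move=> x xs; apply: (mem_drop (mem_take xs)).
- by apply: take_uniq; apply: drop_uniq.
rewrite size_cat /slice size_take size_drop => /(_ isT).
by case: ltnP; nlia.
Qed.

Lemma trail_prefix x R z w :
  trail e x R z -> w \in R ->
  exists R1, trail e x R1 w /\ exists R2, R = R1 ++ R2.
Proof.
case=> r [-> pr _] wr; move: pr; case/splitPl: wr => r1 r2 l1 pr.
exists (x :: r1); split; last by exists r2.
by exists r1; move: pr; rewrite cat_path => /andP[].
Qed.

Lemma outside_nonadj_insertable a : ins a -> e y (q a) = false.
Proof.
by apply: outside_trail_nonadj (trail1 _ _) _ => /=; rewrite yP uP.
Qed.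

Lemma outside_adj_lt i : i < p -> e y (q i) -> i.+1 < p.
Proof.
move=> ip ei.
have [|_] := outside_trail_ends (trail1 e y) _ ip ei; first by rewrite /= yP uP.
by rewrite addn1.
Qed.

Lemma insertable_next i : i < p -> e y (q i) -> ins i.+1.
Proof. by move=> ip ei; rewrite /insertable outside_adj_lt //= esym. Qed.

End LongestPath.

(** * Counting neighbours along the path *)

Lemma card_in_seq (T : finType) (x0 : T) (P : seq T) (A : pred T) :
  uniq P ->
  #|[set z in P | A z]| = \sum_(0 <= i < size P) (A (nth x0 P i) : nat).
Proof.
move=> uP; rewrite -(big_nth x0 xpredT (fun z => (A z : nat))) big_uniq //=.
rewrite -sum1dep_card big_mkcondr /=.
by apply: eq_bigr => z _; case: (A z).
Qed.

(** Spreads a constant as a sum concentrated at [b], so that inequalities can be compared index by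
    index. *)
Lemma sum_nat_eq (n b X : nat) :
  b < n -> \sum_(0 <= c < n) (c == b) * X = X.
Proof.
move=> bn; rewrite big_mkord (bigD1 (Ordinal bn)) //= eqxx mul1n big1 ?addn0 //.
by move=> i /negP ib; case: eqP => // eq; case: ib; apply/eqP/val_inj.
Qed.

Lemma sum_nat_le1 (m n : nat) (F : nat -> nat) :
  (forall j, m <= j < n -> F j <= 1) -> \sum_(m <= j < n) F j <= n - m.
Proof.
move=> F1; rewrite -[X in _ <= X]muln1 -sum_nat_const_nat.
by rewrite big_nat [X in _ <= X]big_nat; apply: leq_sum.
Qed.

Section Counting.
Variables (T : finType) (e : rel T).
Hypotheses (esym : symmetric e) (eirr : irreflexive e).
Variables (P : seq T) (y : T).
Hypotheses (lgP : longest e P) (yP : y \notin P).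

Local Notation p := (size P).
Local Notation q := (nth y P).
Local Notation ins := (insertable e P y).
Local Notation swp := (swappable e P y).

Let uP : uniq P. Proof. by case: lgP. Qed.

Definition outdeg (v : T) := #|[set z | e v z & z \notin P]|.

Lemma deg_split v :
  deg e v = \sum_(0 <= i < p) (e v (q i) : nat) + outdeg v.
Proof.
rewrite /deg /outdeg -(cardsID [set z in P] [set z | e v z]).
rewrite -(card_in_seq y (e v) uP); congr (_ + _); apply: eq_card => z.
  by rewrite !inE andbC.
by rewrite !inE andbC.
Qed.

Definition insertable_set := [set v in P | ins (index v P)].

Lemma insertable_setP v :
  reflect (exists2 c, ins c & v = q c) (v \in insertable_set).
Proof.
apply: (iffP idP) => [|[c ic ->]].
  by rewrite inE => /andP[vP iv]; exists (index v P); rewrite ?nth_index.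
have cp := insertable_lt ic.
by rewrite inE mem_nth //= index_uniq.
Qed.

(** The positive insertable indices are the successors of the neighbours of [y], the last vertex of
    [P] not being one; index [0] adds one more. *)
Lemma sum_insertable : 0 < p ->
  \sum_(0 <= c < p) (ins c : nat) = #|[set z in P | e y z]|.+1.
Proof.
move=> p0; rewrite (card_in_seq y) // -(prednK p0) big_nat_recl //.
rewrite insertable0 // add1n; congr _.+1.
rewrite [RHS]big_nat_recr //= (_ : e y (q p.-1) = false); last first.
  by apply/negP => /(outside_adj_lt esym lgP yP); lia.
rewrite addn0; apply: eq_big_nat => i /andP[_ ip].
by rewrite /insertable /= esym; case: (e y _); lia.
Qed.

Lemma card_insertable : 0 < p ->
  #|insertable_set| = #|[set z in P | e y z]|.+1.
Proof.
move=> p0; rewrite -sum_insertable // (card_in_seq y) //.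
by apply: eq_big_nat => i /andP[_ ip]; rewrite index_uniq.
Qed.

Lemma sum_insertable_set (F : T -> nat) :
  \sum_(v in insertable_set) F v = \sum_(0 <= c < p) ins c * F (q c).
Proof.
rewrite (big_nat _ _) [RHS](_ : _ = \sum_(0 <= c < p) (ins (index (q c) P)) * F (q c)).
  rewrite -(big_nth y xpredT (fun v => ins (index v P) * F v)) big_uniq //=.
  rewrite (eq_bigl (fun v => (v \in P) && ins (index v P))); last by move=> v; rewrite inE.
  by rewrite big_mkcondr; apply: eq_bigr => v _; case: ins; rewrite ?mul1n.
by rewrite -big_nat; apply: eq_big_nat => i /andP[_ ip]; rewrite index_uniq.
Qed.

Lemma insertable_set_indep u v :
  u \in insertable_set -> v \in insertable_set -> e u v = false.
Proof.
move=> /insertable_setP[a ia ->] /insertable_setP[b ib ->].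
have [ab|ba|->] := ltngtP a b; last exact: eirr.
  exact: (insertable_nonadj esym lgP yP).
by rewrite esym; apply: (insertable_nonadj esym lgP yP).
Qed.

Lemma outside_insertable_le1 z : z \notin P -> z != y ->
  #|[set v in insertable_set | e z v]| <= 1.
Proof.
move=> zP zy; apply/card_le1_eqP => u v; rewrite !inE -!/(_ \in insertable_set).
have aux (a b : nat) : ins a -> ins b -> e z (q a) -> e z (q b) -> a <= b.
  move=> ia ib ea eb; rewrite leqNgt; apply/negP => ba.
  have := outside_insertable_nonadj esym lgP yP zP zy ba ib ia.
  by rewrite ea eb.
move=> /andP[/andP[uP' iu] eu] /andP[/andP[vP iv] ev].
rewrite -(nth_index y uP') -(nth_index y vP); congr nth; apply/eqP.
by rewrite eqn_leq !aux ?nth_index.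
Qed.

(** Double counting of the edges leaving [P] from insertable vertices: a vertex off [P] receives at
    most one of them, and a vertex of [R] none. *)
Lemma sum_outdeg R w : trail e y R w -> uniq (R ++ P) ->
  \sum_(v in insertable_set) outdeg v + size R + p <= #|T|.
Proof.
move=> tR uR.
have -> : \sum_(v in insertable_set) outdeg v
        = \sum_z \sum_(v in insertable_set | e v z && (z \notin P)) 1.
  under eq_bigr => v _ do rewrite /outdeg -sum1dep_card big_mkcond /=.
  rewrite exchange_big /=; apply: eq_bigr => z _.
  by rewrite [RHS]big_mkcondr.
rewrite -addnA -size_cat -(card_uniqP uR).
rewrite -[X in _ <= X](cardC [in R ++ P]) [X in _ <= X]addnC leq_add2r.
rewrite -sum1_card [X in _ <= X]big_mkcond /=.
apply: leq_sum => z _; rewrite sum1dep_card !inE mem_cat negb_or.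
have [zP|zP] /= := boolP (z \in P).
  rewrite andbF leqn0 cards_eq0; apply/eqP/setP => v.
  by rewrite !inE !andbF.
(* A vertex of [R] ends an initial trail of [R], which could be inserted whole into [P]. *)
rewrite andbT; have [zR|zR] /= := boolP (z \in R).
  rewrite leqn0 cards_eq0; apply/eqP/setP => v; rewrite !inE andbT.
  apply/negP => /andP[/andP[vP iv] evz].
  have [R1 [t1 [R2 eR]]] := trail_prefix tR zR.
  have u1 : uniq (R1 ++ P).
    move: uR; rewrite eR -catA !cat_uniq has_cat negb_or => /and3P[-> /andP[_ ->]].
    by rewrite uP.
  have := outside_trail_nonadj lgP t1 u1 iv.
  by rewrite nth_index // esym evz.
have zy : z != y.
  by apply: contraNneq zR => ->; case: tR => r [-> _ _]; rewrite inE eqxx.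
rewrite (eq_card (B := [set v in insertable_set | e z v])).
  exact: outside_insertable_le1.
by move=> v; rewrite !inE andbT [e v z]esym.
Qed.

(** At such an index both degree terms of the following count vanish, so its slot is free for an
    extra unit. *)
Definition fixed_index (b : nat) : pred nat :=
  fun j => [&& ins j, ~~ swp j, j != 0 & j != b].

(* The two neighbourhoods are shifted against each other along [P], in
   opposite directions before and after [b]; crossing edges being excluded,
   each of the [p - 1] edges of [P] is charged at most once. *)
Lemma pair_degree_on_path b : ins b -> 0 < b ->
  \sum_(0 <= i < p) (e (q 0) (q i) : nat) +
  \sum_(0 <= i < p) (e (q b) (q i) : nat) +
  \sum_(0 <= j < p) (fixed_index b j : nat) <= p.-1.
Proof.
move=> ib b0; have bp := insertable_lt ib.
have i0 : ins 0 by apply: insertable0; nlia.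
pose A i : nat := e (q 0) (q i); pose B i : nat := e (q b) (q i).
pose D j : nat := fixed_index b j.
rewrite -/(A _) -/(B _) -/(D _).
have indep := insertable_nonadj esym lgP yP.
have A0 : A 0 = 0 by rewrite /A eirr.
have Ab : A b = 0 by rewrite /A indep.
have Bb : B b = 0 by rewrite /B eirr.
have p0 : 0 < p by nlia.
(* Here the second edge of the rerouting is void, so one adjacency is already contradictory. *)
have Al : A p.-1 = 0.
  rewrite /A; case: (boolP (e _ _)) => // el; exfalso.
  apply: (@crossing_right _ _ esym P y lgP yP 0 b p.-1) => //; try nlia.
  by rewrite esym.
have Dl : D p.-1 = 0.
  by rewrite /D /fixed_index /swappable prednK // eqxx /= andbF.
(* Before [b], the edge from [j] to [j + 1] is charged with [j + 1] as neighbour of [q 0] and [j] as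
   neighbour of [q b]; from [b] on the roles are exchanged. *)
have slot1 j : j < b -> A j.+1 + B j + D j <= 1.
  move=> jb; have [ejb|ejb] := boolP (fixed_index b j).
    have /and4P[ij nsj j0 jb'] := ejb.
    rewrite {1}/A {1}/B {1}/D ejb [e (q b) _]esym (indep j b) //.
    move: nsj; rewrite /swappable !negb_or => /and3P[_ _ /existsPn nx].
    have := nx (Ordinal p0); rewrite /= i0 esym => /=.
    by rewrite eq_sym j0 /= => /negbTE ->.
  rewrite {1}/D (negbTE ejb) addn0.
  have [->|jb1] := eqVneq j.+1 b; first by rewrite Ab /B; case: (e _ _).
  have := @crossing_between _ _ esym P y lgP yP 0 b j isT _ i0 ib.
  rewrite ltn_neqAle jb1 jb => /(_ isT); rewrite /A /B [e (q j) _]esym [e (q j.+1) _]esym.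
  by case: (e _ _); case: (e _ _).
have slot2 j : b <= j -> j.+1 < p -> A j + B j.+1 + D j <= 1.
  move=> bj jp; have [ejb|ejb] := boolP (fixed_index b j).
    have /and4P[ij nsj j0 jb'] := ejb.
    rewrite {1}/A {1}/B {1}/D ejb (indep 0 j) ?lt0n //.
    move: nsj; rewrite /swappable !negb_or => /and3P[_ _ /existsPn nx].
    have := nx (Ordinal bp); rewrite /= ib esym => /=.
    by rewrite eq_sym jb' /= => /negbTE ->.
  rewrite {1}/D (negbTE ejb) addn0 /A /B.
  case: (boolP (e (q 0) _)) => // e0; case: (boolP (e (q b) _)) => // e1; exfalso.
  by apply: (@crossing_right _ _ esym P y lgP yP 0 b j) => //; [nlia|rewrite esym|rewrite esym].
(* The terms at [0], [b] and the last index vanish, so the shifts lose nothing. *)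
have -> : \sum_(0 <= i < p) A i = \sum_(0 <= j < b) A j.+1 + \sum_(b <= j < p.-1) A j.
  have -> : \sum_(0 <= i < p) A i = \sum_(0 <= i < p.-1) A i.
    by rewrite -[in LHS](prednK p0) big_nat_recr //= Al addn0.
  rewrite (@big_cat_nat _ _ _ b) //=; last by nlia.
  congr (_ + _); have := @big_nat_recl nat 0 addn b 0 A isT.
  by rewrite big_nat_recr //= Ab A0 addn0 add0n.
have -> : \sum_(0 <= i < p) B i = \sum_(0 <= j < b) B j + \sum_(b <= j < p.-1) B j.+1.
  rewrite (@big_cat_nat _ _ _ b) //=; last by nlia.
  by congr (_ + _); rewrite big_ltn // Bb add0n big_add1.
have -> : \sum_(0 <= i < p) D i = \sum_(0 <= j < b) D j + \sum_(b <= j < p.-1) D j.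
  have -> : \sum_(0 <= i < p) D i = \sum_(0 <= i < p.-1) D i.
    by rewrite -[in LHS](prednK p0) big_nat_recr //= Dl addn0.
  by rewrite (@big_cat_nat _ _ _ b) //=; nlia.
have S1 : \sum_(0 <= j < b) (A j.+1 + B j + D j) <= b.
  by rewrite -[X in _ <= X]subn0; apply: sum_nat_le1 => j /slot1.
have S2 : \sum_(b <= j < p.-1) (A j + B j.+1 + D j) <= p.-1 - b.
  by apply: sum_nat_le1 => j /andP[bj jp]; apply: slot2 => //; nlia.
move: S1 S2; rewrite !big_split /=; nlia.
Qed.

End Counting.

(** * A swappable vertex with all neighbours on the path *)

Section SwapOut.
Variables (T : finType) (e : rel T).
Hypotheses (esym : symmetric e) (eirr : irreflexive e).
Variables (P : seq T) (y : T).
Hypotheses (lgP : longest e P) (yP : y \notin P).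

Local Notation p := (size P).
Local Notation q := (nth y P).
Local Notation ins := (insertable e P y).
Local Notation swp := (swappable e P y).
Local Notation out := (outdeg e P).
Local Notation k := #|[set z in P | e y z]|.

Let uP : uniq P. Proof. by case: lgP. Qed.

(* Indices of neighbours of [y], their successors, and those second successors
   whose predecessor is not swappable, are pairwise distinct; none of them
   lies within [size R] of the ends of [P]. *)
Lemma spread_neighbours R z : trail e y R z -> uniq (R ++ P) ->
  0 < k ->
  (forall c, ins c -> swp c -> 0 < out (q c)) ->
  3 * k + 2 * size R <= p + 2 + \sum_(0 <= c < p) ins c * out (q c).
Proof.
move=> tR uR k0 outpos.
(* [N] marks neighbours of [y], and [M] those whose successor is not swappable. *)
pose N i := (i < p) && e y (q i).
pose M i := [&& i < p, e y (q i) & ~~ swp i.+1].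
have ends i : N i -> size R <= i /\ i.+1 + size R <= p.
  by rewrite /N => /andP[ip ei]; apply: (outside_trail_ends esym lgP tR).
have sumN : \sum_(0 <= i < p) N i = k.
  rewrite (card_in_seq y) //; apply: eq_big_nat => i /andP[_ ip].
  by rewrite /N ip.
have [i0 Ni0] : exists i, N i.
  case/card_gt0P: k0 => w; rewrite inE => /andP[wP ew].
  by exists (index w P); rewrite /N index_mem wP nth_index // ew.
have [r1 r2] := ends _ Ni0.
have MN i : M i -> N i by rewrite /M /N => /and3P[-> ->].
(* A neighbour outside [M] has a swappable successor, which contributes at least one to the sum of
   [out]. *)
have sumM : k <= \sum_(0 <= i < p) M i + \sum_(0 <= c < p) ins c * out (q c).
  have p0 : 0 < p by nlia.
  have le : \sum_(0 <= i < p) N i <= \sum_(0 <= i < p) (M i + ins i.+1 * out (q i.+1)).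
    rewrite big_nat [X in _ <= X]big_nat; apply: leq_sum => i /andP[_ ip].
    rewrite /N /M ip /=; case: (boolP (e y (q i))) => //= ei.
    have ii := insertable_next esym lgP yP ip ei.
    rewrite ii mul1n; case: (boolP (swp _)) => //= sw.
    exact: outpos.
  rewrite -sumN; apply: leq_trans le _; rewrite big_split /= leq_add2l.
  rewrite -[X in _ <= X]addn0.
  have -> : \sum_(0 <= i < p) ins i.+1 * out (q i.+1) =
            \sum_(0 <= i < p.-1) ins i.+1 * out (q i.+1) + 0.
    rewrite -[in LHS](prednK p0) big_nat_recr //=; congr (_ + _).
    by rewrite prednK // /insertable ltnn.
  rewrite leq_add2r -[in X in _ <= X](prednK p0) [X in _ <= X]big_nat_recl //.
  exact: leq_addl.
have NN i : N i -> N i.+1 = false.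
  rewrite /N => /andP[ip ei]; have ii := insertable_next esym lgP yP ip ei.
  by rewrite (outside_nonadj_insertable lgP yP ii) andbF.
have NM i : M i -> N i.+2 = false.
  rewrite /M /N /swappable => /and3P[_ _]; rewrite !negb_or => /and3P[_ /negbTE -> _].
  by rewrite andbF.
(* The shifts by one and two can pass the end of [P], hence the range [p.+2] below. *)
pose N1 m := if m is m'.+1 then N m' else false.
pose M2 m := if m is m'.+2 then M m' else false.
have tot : \sum_(0 <= m < p.+2) (N m + N1 m + M2 m)
     <= \sum_(0 <= m < p.+2) ((size R <= m) && (m + size R <= p.+1) : nat).
  apply: leq_sum => m _.
  have [Nm|Nm] := boolP (N m).
    have -> : N1 m = false.
      by case: m Nm => // m Nm /=; apply: contraTF Nm => /NN ->.
    have -> : M2 m = false.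
      by case: m Nm => // -[] // m Nm /=; apply: contraTF Nm => /NM ->.
    by have [a b] := ends _ Nm; rewrite a (leq_trans _ (leqW b)) // leqW // leq_add2r leqnSn.
  have [N1m|N1m] := boolP (N1 m).
    have -> : M2 m = false.
      by case: m N1m Nm => // -[] // m /= Nm _; apply: contraTF Nm => /MN /NN ->.
    by case: m N1m {Nm} => // m Nm; have [a b] := ends _ Nm; rewrite leqW // (leq_trans b).
  have [M2m|//] := boolP (M2 m).
  case: m M2m {Nm N1m} => // -[] // m /MN Nm; have [a b] := ends _ Nm.
  have -> : size R <= m.+2 by move: a; clear; nlia.
  have -> : m.+2 + size R <= p.+1 by move: b; clear; nlia.
  by [].
have rhs : \sum_(0 <= m < p.+2) ((size R <= m) && (m + size R <= p.+1) : nat)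
     <= p.+2 - 2 * size R.
  rewrite (@big_cat_nat _ _ _ (size R)) //=; last by nlia.
  rewrite [X in X + _]big_nat [X in X + _]big1 ?add0n; last first.
    by move=> i /andP[_ ir]; rewrite leqNgt ir.
  rewrite (@big_cat_nat _ _ _ (p.+2 - size R)) //=; [|nlia|nlia].
  rewrite [X in _ + X]big_nat [X in _ + X]big1 ?addn0; last first.
    move=> i /andP[ri _]; have -> : (i + size R <= p.+1) = false by nlia.
    by rewrite andbF.
  apply: leq_trans (_ : _ <= p.+2 - size R - size R) _; last by nlia.
  by apply: sum_nat_le1 => j _; case: (_ && _).
have S1 : k <= \sum_(0 <= m < p.+2) N m.
  by rewrite !big_nat_recr //= sumN -addnA leq_addr.
have S2 : k <= \sum_(0 <= m < p.+2) N1 m.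
  by rewrite big_nat_recl // add0n big_nat_recr //= sumN leq_addr.
have S3 : \sum_(0 <= m < p) M m <= \sum_(0 <= m < p.+2) M2 m.
  by rewrite !big_nat_recl // !add0n.
move: (leq_trans tot rhs) S1 S2 S3 sumM; rewrite !big_split /=; clear -r1 r2; nlia.
Qed.

(** The degree condition is applied to the far end [z] of [R], which is nonadjacent to all
    insertable vertices. This covers both a maximal path [R] off [P] and the single vertex [y]. *)
Lemma exists_swappable_inner (d : nat) R z :
  trail e y R z -> uniq (R ++ P) -> 0 < k ->
  deg e z <= k + (size R).-1 ->
  (forall u v, u != v -> ~~ e u v -> #|T| <= deg e u + deg e v + d) ->
  3 * d <= #|T| ->
  exists c, [/\ ins c, swp c & forall w, e (q c) w -> w \in P].
Proof.
move=> tR uR k0 degz sig d3.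
have [/existsP[c /and3P[ic sc /forallP inn]]|no] :=
  boolP [exists c : 'I_p, [&& ins c, swp c & [forall w, e (q c) w ==> (w \in P)]]].
  by exists c; split => // w; apply/implyP.
exfalso.
have outpos c : ins c -> swp c -> 0 < out (q c).
  move=> ic sc; have cp := insertable_lt ic.
  move/existsPn: no => /(_ (Ordinal cp)); rewrite /= ic sc /=.
  case/forallPn=> w; rewrite negb_imply => /andP[ew wP].
  by apply/card_gt0P; exists w; rewrite inE ew wP.
have := spread_neighbours tR uR k0 outpos.
have := sum_outdeg esym lgP yP tR uR.
rewrite sum_insertable_set //; set S := \sum_(0 <= c < p) _ => sumS spread.
have [w] := card_gt0P k0; rewrite inE => /andP[wP ew].
have ip : index w P < p by rewrite index_mem.
have ei : e y (q (index w P)) by rewrite nth_index.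
set b := (index w P).+1.
have ib : ins b by apply: insertable_next.
have bp := insertable_lt ib.
have p0 : 0 < p by nlia.
have i0 : ins 0 by apply: insertable0.
have pair := pair_degree_on_path esym eirr lgP yP ib isT.
set D := \sum_(0 <= j < p) (fixed_index _ _ _ _ _ : nat) in pair.
(* An insertable index other than [0] and [b] is either fixed or swappable; in the latter case it
   has an outside neighbour and is counted in [S]. *)
have cnt : k.+1 + out (q 0) + out (q b) <= 2 + D + S.
  rewrite -(sum_insertable esym lgP yP p0).
  rewrite -[X in _ + X + _](@sum_nat_eq p 0) // -[X in _ + X](@sum_nat_eq p b) //.
  rewrite -{1}[2]/(1 + 1) -[X in X + _ + _ + _](@sum_nat_eq p 0) //.
  rewrite -[X in _ + X + _ + _](@sum_nat_eq p b 1) // -!big_split /=.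
  apply: leq_sum => c _; rewrite /fixed_index.
  case: (eqVneq c 0) => [->|c0] /=.
    by rewrite i0; nlia.
  case: (eqVneq c b) => [->|cb] /=.
    by rewrite ib !andbF; nlia.
  rewrite !andbT; case: (boolP (ins c)) => //= ic.
  by case: (boolP (swp c)) => //= sc; have := outpos _ ic sc; nlia.
have n0 := outside_trail_nonadj lgP tR uR i0.
have nb := outside_trail_nonadj lgP tR uR ib.
have zq c : ins c -> z != q c.
  move=> ic; apply/eqP => zc; have cp := insertable_lt ic.
  have zP : z \in P by rewrite zc mem_nth.
  have zR : z \in R by case: tR => r [-> _ <-]; apply: mem_last.
  move: uR; rewrite cat_uniq => /and3P[_ /hasPn /(_ _ zP)] /=.
  by rewrite zR.
have g0 := sig _ _ (zq _ i0) (negbT n0).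
have gb := sig _ _ (zq _ ib) (negbT nb).
have R0 : 0 < size R by case: tR => r [->].
rewrite [deg e (q _)](@deg_split T e P y lgP) in g0.
rewrite [deg e (q _)](@deg_split T e P y lgP) in gb.
(* With [n] the order and [r = size R], the degree bounds give [n <= k + r - 2 + 2 * d], so
   [n <= 3 * k + 3 * r - 6] by [3 * d <= n]; but [spread] and [sumS] give
   [3 * k + 3 * r <= n + 2]. *)
nlia.
Qed.

End SwapOut.

(** * Choosing the longest path and the outside vertex *)

Lemma exists_longest (T : finType) (e : rel T) : exists P : seq T, longest e P.
Proof.
pose pth m := [exists s : m.-tuple T, uniq s && sorted e s].
have ex0 : exists m, pth m by exists 0; apply/existsP; exists [tuple].
have bnd m : pth m -> m <= #|T|.
  case/existsP=> s /andP[us _]; rewrite -(size_tuple s) -(card_uniqP us).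
  exact: max_card.
case: (ex_maxnP ex0 bnd) => m /existsP[s /andP[us ss]] mmax.
exists s; split=> // r ur sr; rewrite size_tuple; apply: mmax.
by apply/existsP; exists (in_tuple r); rewrite /= ur.
Qed.

Lemma longest_swap (T : finType) (e : rel T) (P : seq T) (y : T) (c : nat) :
  symmetric e -> irreflexive e -> longest e P -> y \notin P ->
  insertable e P y c -> swappable e P y c ->
  (forall w, e (nth y P c) w -> w \in P) ->
  exists P', [/\ longest e P', nth y P c \notin P' &
                 forall w, e (nth y P c) w -> w \in P'].
Proof.
move=> esym eirr lgP yP ic sc inn; have [uP sP maxP] := lgP.
have [P' sP' pP'] := swappable_path esym eirr lgP ic sc.
have /= /andP[qP' uP'] : uniq (nth y P c :: P').
  by rewrite (perm_uniq pP') /= yP uP.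
have szP' : size P' = size P by have /= [] := perm_size pP'.
exists P'; split=> //.
  by split=> // s us ss; rewrite szP'; apply: maxP.
move=> w ew; have := perm_mem pP' w; rewrite !inE (inn _ ew) orbT.
by case: eqP => // wq; rewrite wq eirr in ew.
Qed.

Lemma exists_maximal_outside_path (T : finType) (e : rel T) (P : seq T) (y : T) :
  uniq P -> y \notin P ->
  exists r, [/\ path e y r, uniq (y :: r ++ P) &
    forall w, e (last y r) w -> (w \in P) || (w \in y :: r)].
Proof.
move=> uP yP.
pose pth m := [exists r : m.-tuple T, path e y r && uniq (y :: r ++ P)].
have ex0 : exists m, pth m.
  by exists 0; apply/existsP; exists [tuple]; rewrite /= yP uP.
have bnd m : pth m -> m <= #|T|.
  case/existsP=> r /andP[_ /= /andP[_]]; rewrite cat_uniq => /andP[ur _].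
  by rewrite -(size_tuple r) -(card_uniqP ur) max_card.
case: (ex_maxnP ex0 bnd) => m /existsP[r /andP[pr ur]] mmax.
exists r; split=> // w ew; rewrite -[_ || _]negbK negb_or; apply/negP => /andP[wP wr].
suff /mmax : pth m.+1 by rewrite ltnn.
apply/existsP; exists [tuple of rcons r w]; rewrite rcons_path pr ew.
rewrite (_ : y :: _ ++ P = (y :: r) ++ [:: w] ++ P); last by rewrite /= cat_rcons.
rewrite (perm_uniq (permEl (perm_catCA _ _ _))) cat1s cons_uniq ur andbT.
by rewrite mem_cat negb_or wP wr.
Qed.

Section Nontraceable.
Variables (T : finType) (e : rel T) (d : nat).
Hypotheses (esym : symmetric e) (eirr : irreflexive e).
Hypothesis con : connected e.
Hypothesis sig :
  forall u v, u != v -> ~~ e u v -> #|T| <= deg e u + deg e v + d.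
Hypothesis d3 : 3 * d <= #|T|.
Hypothesis noham : ~ (exists s : seq T, hamiltonian_path e s).

Lemma longest_misses P : longest e P -> exists y, y \notin P.
Proof.
case=> uP sP _; have [/forallP allP|/forallPn[y yP]] := boolP [forall y, y \in P].
  by case: noham; exists P; split.
by exists y.
Qed.

Lemma longest_nonempty P y : longest e P -> y \notin P -> exists x, x \in P.
Proof.
case: P => [|x P] lgP _; last by exists x; rewrite inE eqxx.
by case: lgP => _ _ /(_ [:: y] isT isT).
Qed.

Lemma exists_inner :
  exists P y, [/\ longest e P, y \notin P & forall w, e y w -> w \in P].
Proof.
have [P lgP] := exists_longest e; have [uP _ _] := lgP.
have [y0 y0P] := longest_misses lgP; have [x xP] := longest_nonempty lgP y0P.
have [y1 y1P [x1 x1P exy]] : exists2 y1, y1 \notin P & exists2 x1, x1 \in P & e y1 x1.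
  have [/existsP[y1 /existsP[x1 /and3P[]]]|no] :=
    boolP [exists y1, exists x1, [&& y1 \notin P, x1 \in P & e y1 x1]].
    by move=> *; exists y1 => //; exists x1.
  (* Without an edge leaving [P], connectedness would put every vertex on [P]. *)
  have cl : closed e [in P].
    apply: intro_closed => [|u v euv uP']; first exact: sym_connect_sym.
    rewrite -[_ \in _]negbK; apply/negP => vP; case/negP: no.
    by apply/existsP; exists v; apply/existsP; exists u; rewrite vP uP' esym euv.
  by move: y0P; rewrite -(closed_connect cl (con x y0)) xP.
(* By this choice [k] also bounds the number of neighbours on [P] of the end [z] of any trail off
   [P]. *)
have := @arg_maxnP T y1 (fun y => y \notin P) (fun y => #|[set z in P | e y z]|) y1P.
case=> y yP ymax.
have k0 : 0 < #|[set z in P | e y z]|.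
  apply: leq_trans (ymax _ y1P); apply/card_gt0P; exists x1.
  by rewrite inE x1P exy.
have [r [pr ur last_in]] := exists_maximal_outside_path e uP yP.
set z := last y r in last_in.
have tR : trail e y (y :: r) z by exists r.
have zP : z \notin P.
  move: ur; rewrite -cat_cons cat_uniq => /and3P[_ /hasPn dis _].
  by apply/negP => /dis /=; rewrite mem_last.
(* By maximality of [r], the neighbours of [z] off [P] lie among the other vertices of [y :: r]. *)
have degz : deg e z <= #|[set z in P | e y z]| + (size (y :: r)).-1.
  have sub : [set w | e z w] \subset [set w in P | e z w] :|: ([set w in y :: r] :\ z).
    apply/subsetP => w; rewrite !inE => ew; rewrite ew andbT.
    have -> /= : w != z by apply: contraTneq ew => ->; rewrite eirr.
    by have := last_in _ ew; rewrite inE.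
  apply: leq_trans (subset_leq_card sub) _; apply: leq_trans (leq_card_setU _ _) _.
  apply: leq_add; first exact: ymax.
  rewrite /= -ltnS -(_ : #|[set w in y :: r]| = (size r).+1).
    by rewrite (cardsD1 z [set w in y :: r]) inE mem_last.
  rewrite cardsE; apply/card_uniqP.
  by move: ur; rewrite -cat_cons cat_uniq => /andP[].
have [c [ic sc inn]] :=
  exists_swappable_inner esym eirr lgP yP tR ur k0 degz sig d3.
have [P' [? ? ?]] := longest_swap esym eirr lgP yP ic sc inn.
by exists P', (nth y P c).
Qed.

(** Swapping continues while the degree of the outside vertex grows. When it does not, the degree
    condition for [y] and the nonadjacent [u] gives the bound. *)
Lemma exists_inner_big_degree :
  exists P y, [/\ longest e P, y \notin P, forall w, e y w -> w \in P &
                  #|T| <= 2 * deg e y + d].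
Proof.
have [P0 [y0 [lgP0 yP0 inn0]]] := exists_inner.
have [m] := ubnP (#|T| - deg e y0); elim: m P0 y0 lgP0 yP0 inn0 => // m IH P y lgP yP inn lem.
have [uP _ _] := lgP.
have eqN : [set z in P | e y z] = [set z | e y z].
  by apply/setP => z; rewrite !inE; case: (boolP (e y z)) => [/inn ->|]; rewrite ?andbF.
have k0 : 0 < #|[set z in P | e y z]|.
  have [x xP] := longest_nonempty lgP yP.
  rewrite eqN; case/connectP: (con y x) => -[|w s] /= => [_ xy|/andP[eyw _] _].
    by rewrite -xy xP in yP.
  by apply/card_gt0P; exists w; rewrite inE.
have uyP : uniq ([:: y] ++ P) by rewrite /= yP uP.
have degy : deg e y <= #|[set z in P | e y z]| + (size [:: y]).-1.
  by rewrite /= addn0 eqN.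
have [c [ic sc innc]] :=
  exists_swappable_inner esym eirr lgP yP (trail1 e y) uyP k0 degy sig d3.
have [P' [lgP' uP' inn']] := longest_swap esym eirr lgP yP ic sc innc.
set u := nth y P c in uP' inn'.
have [le|gt] := leqP (deg e u) (deg e y).
  exists P, y; split=> //.
  have yu : y != u.
    by apply: contraNneq yP => ->; apply: mem_nth; apply: insertable_lt ic.
  have eyu : ~~ e y u by rewrite (outside_nonadj_insertable lgP yP ic).
  by have := sig yu eyu; lia.
apply: (IH P' u) => //.
have : deg e u <= #|T| by apply: max_card.
by move: lem gt; lia.
Qed.

End Nontraceable.

(** * Averaging, extremal arithmetic and the two target structures *)

(** The two smallest values sum to at least [s], and twice any other value is at least its sum with
    the second smallest. *)
Lemma sum_pairwise_ge (T : finType) (U : {set T}) (f : T -> nat) (s : nat) :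
  1 < #|U| ->
  (forall u v, u \in U -> v \in U -> u != v -> s <= f u + f v) ->
  #|U| * s <= 2 * \sum_(u in U) f u.
Proof.
move=> U1 pair.
have [x0 x0U] : exists x, x \in U by apply/card_gt0P; lia.
have [u0 u0U min0] := @arg_minnP T x0 [in U] f x0U.
have cU := cardsD1 u0 U; rewrite u0U in cU.
have [x1 x1U] : exists x, x \in U :\ u0 by apply/card_gt0P; lia.
have [u1 u1U min1] := @arg_minnP T x1 [in U :\ u0] f x1U.
have cU1 := cardsD1 u1 (U :\ u0); rewrite u1U in cU1.
rewrite (big_setD1 u0) //= (big_setD1 u1) //=.
move: (u1U); rewrite !inE => /andP[u10 u1U'].
have p01 := pair _ _ u0U u1U'; rewrite eq_sym u10 in p01.
have rest : #|(U :\ u0) :\ u1| * s <= \sum_(u in (U :\ u0) :\ u1) 2 * f u.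
  rewrite -sum_nat_const; apply: leq_sum => v; rewrite !inE => /and3P[v1 v0 vU].
  move: (pair _ _ u1U' vU); rewrite eq_sym v1 => /(_ isT).
  move: (min1 v); rewrite !inE v0 vU => /(_ isT).
  by clear; lia.
rewrite -big_distrr /= in rest.
have {}p01 := p01 isT.
have -> : #|U| = #|(U :\ u0) :\ u1| + 2 by lia.
by rewrite mulnDl; lia.
Qed.

(** Here [k = deg y], [o] counts the vertices neither in the independent set nor adjacent to [y],
    [w = d - o - 2], [S] is the degree sum over the insertable vertices, and the order is
    [2 * k + 2 + o]. *)
Lemma extremal_arith (m k o w S : nat) :
  3 <= m -> m * (o + 2 + w) <= 2 * k + 2 + o ->
  (k + 1) * (2 * k) <= 2 * S + (k + 1) * w ->
  S <= k * m + o * (m + 1) ->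
  (0 < o -> S + 2 * m <= k * m + o * (m + 1) + k + 1 \/
            S + m <= k * m + o * (m + 1)) ->
  2 * m < 2 * k + 2 + o -> False.
Proof.
move=> m3 hn hS b1 b2 hm.
case: (posnP o) => [o0|o0].
  subst o; case: (posnP w) => [w0|w0]; first by subst w; nia.
  have h : 2 * m + w <= 2 * k by nia.
  by nia.
(* In these small cases the bound [b1] is too weak and the sharper [b2] decides. *)
have [/andP[/eqP em ol]|big] := boolP ((m == 3) && (o <= 2)).
  subst m; have {}b2 := b2 o0.
  have k3 : o + 2 <= k by lia.
  have hw : 3 * w + 4 + 2 * o <= 2 * k by lia.
  have hw' : (k + 1) * (3 * w + 4 + 2 * o) <= (k + 1) * (2 * k) by rewrite leq_mul2l hw orbT.
  have [eo|eo] : o = 1 \/ o = 2 by lia.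
    by subst o; case: b2 => ?; nia.
  by subst o; case: b2 => ?; nia.
(* First [w] is eliminated by [X + w <= 2 * k], then [k] by [X <= 2 * k]. What remains is
   [X * m' <= 4 * (m' + 2)], which fails for [m' >= 3], and for [m' = 2] forces [o <= 2]. *)
have [m' em] : exists m', m = m'.+1 by exists m.-1; lia.
subst m; pose X := m' * (o + 2).
have XE : X = m' * o + 2 * m' by rewrite /X; nia.
have h1 : X + w <= 2 * k by rewrite XE; clear -hn m3; nia.
have h2 : (k + 1) * X <= 2 * (k * m'.+1) + 2 * (o * (m'.+1 + 1)).
  have : (k + 1) * (X + w) <= (k + 1) * (2 * k) by rewrite leq_mul2l h1 orbT.
  by rewrite mulnDr; lia.
have mo : 2 * 1 <= m' * o by apply: leq_mul => //; lia.
have [Y eY] : exists Y, m' * o = Y.+2 by exists (m' * o - 2); lia.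
have h3 : X * (m' * o) <= 4 * (o * (m'.+1 + 1)).
  have XY : X * Y <= 2 * k * Y by rewrite leq_mul2r; apply/orP; right; lia.
  rewrite eY in XE *.
  have {}h2 : k * Y + X <= 2 * (o * (m'.+1 + 1)).
    have EX : (k + 1) * X = k * Y + 2 * (k * m'.+1) + X.
      by rewrite mulnDl mul1n XE; clear; lia.
    by move: h2; rewrite EX; move: (o * _) (k * Y) (k * _); clear; lia.
  rewrite -addn2 mulnDr; move: XY h2; rewrite -mulnA.
  by move: (o * _) (k * Y) (X * Y); clear; lia.
have h4 : X * m' <= 4 * (m'.+1 + 1).
  by rewrite -(leq_pmul2r o0); move: h3; nia.
have [m2|m3'] : m' = 2 \/ 3 <= m' by lia.
  by subst m'; move: big h4; rewrite /X; clear; lia.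
have : 3 * 3 * m' <= X * m'.
  by rewrite leq_mul2r /X leq_mul ?orbT //; lia.
by move: h4; clear -m3'; lia.
Qed.

Lemma induced_star (T : finType) (e : rel T) (t : nat) (I : {set T}) (v : T) :
  symmetric e -> irreflexive e ->
  {in I &, forall x z, e x z = false} -> t <= #|[set u in I | e v u]| ->
  has_induced (@star_rel t) e.
Proof.
move=> esym eirr indep; rewrite cardE; set s := enum _ => ts.
have vs : v \notin s by rewrite mem_enum inE eirr andbF.
have us : uniq (v :: s) by rewrite /= vs enum_uniq.
have lt (i : 'I_t.+1) : i < size (v :: s) by have := ltn_ord i; rewrite /=; lia.
(* Position [0] holds the centre, matching [ord0]; the first [t] entries of [s] are the leaves. *)
exists (fun i : 'I_t.+1 => nth v (v :: s) i); split.
  move=> i j /eqP; rewrite nth_uniq // => /eqP; exact: val_inj.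
have adj (j : nat) : j < size s -> e v (nth v s j).
  by move=> js; have := mem_nth v js; rewrite mem_enum inE => /andP[].
have inI (j : nat) : j < size s -> nth v s j \in I.
  by move=> js; have := mem_nth v js; rewrite mem_enum inE => /andP[].
move=> i j; rewrite /star_rel -!val_eqE /=.
have := lt i; have := lt j; case: (val i) => [|i'] /=; case: (val j) => [|j'] /= lj li.
- by rewrite eirr.
- by rewrite adj.
- by rewrite esym adj.
- by rewrite indep ?inI // andbF.
Qed.

Lemma complete_join (T : finType) (e : rel T) (I : {set T}) (a b : nat) :
  symmetric e -> irreflexive e ->
  #|~: I| = a -> #|I| = b ->
  {in I &, forall x z, e x z = false} ->
  (forall u v, u \in I -> v \notin I -> e u v) ->
  exists h : rel 'I_a, simple_graph h /\ isomorphic (@join_empty _ 'I_b h) e.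
Proof.
move=> esym eirr <- <- indep full.
exists (fun i j => e (enum_val i) (enum_val j)); split; first by split=> [i j|i].
pose phi (s : 'I_#|~: I| + 'I_#|I|) : T :=
  match s with inl i => enum_val i | inr j => enum_val j end.
have outI (i : 'I_#|~: I|) : enum_val i \notin I.
  by have := enum_valP i; rewrite inE.
have inI (j : 'I_#|I|) : enum_val j \in I by apply: enum_valP.
exists phi; split.
  apply: inj_card_bij; last by rewrite card_sum !card_ord addnC cardsC.
  move=> [i|i] [j|j] /= eq.
  - by congr inl; apply: enum_val_inj.
  - by have := outI i; rewrite eq inI.
  - by have := outI j; rewrite -eq inI.
  - by congr inr; apply: enum_val_inj.
move=> [i|i] [j|j] //=.
- by rewrite esym full.
- by rewrite full.
- by rewrite indep.
Qed.

(** * Degrees into the independent set *)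

Section Extremal.
Variables (T : finType) (e : rel T) (d m : nat).
Hypotheses (esym : symmetric e) (eirr : irreflexive e).
Hypothesis sig :
  forall u v, u != v -> ~~ e u v -> #|T| <= deg e u + deg e v + d.
Variables (P : seq T) (y : T).
Hypotheses (lgP : longest e P) (yP : y \notin P).
Hypothesis inn : forall w, e y w -> w \in P.
Hypothesis deg0 : 0 < deg e y.
Hypothesis degy : #|T| <= 2 * deg e y + d.

Local Notation p := (size P).
Local Notation q := (nth y P).
Local Notation ins := (insertable e P y).
Local Notation U := (insertable_set e P y).
Local Notation k := (deg e y).
Local Notation N := [set v | e y v].

Definition star_leaves := y |: U.
Local Notation I := star_leaves.

Let uP : uniq P. Proof. by case: lgP. Qed.

Let nbrP : [set z in P | e y z] = N.
Proof.
by apply/setP => z; rewrite !inE; case: (boolP (e y z)) => [/inn ->|]; rewrite ?andbF.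
Qed.

Let p0 : 0 < p.
Proof.
case/card_gt0P: deg0 => w; rewrite inE => /inn.
by case: (P).
Qed.

Lemma card_insertable_inner : #|U| = k.+1.
Proof. by rewrite (card_insertable esym lgP yP p0) nbrP. Qed.

Lemma notin_insertable_set : y \notin U.
Proof. by rewrite inE (negbTE yP). Qed.

Lemma insertable_set_nonadj u : u \in U -> e y u = false.
Proof.
by case/insertable_setP=> // c ic ->; apply: (outside_nonadj_insertable lgP yP).
Qed.

Lemma card_star_leaves : #|I| = k.+2.
Proof. by rewrite cardsU1 notin_insertable_set card_insertable_inner. Qed.

Lemma indep_star_leaves : {in I &, forall x z, e x z = false}.
Proof.
move=> x z; rewrite !in_setU1 => /orP[/eqP->|xU] /orP[/eqP->|zU].
- exact: eirr.
- exact: insertable_set_nonadj.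
- by rewrite esym insertable_set_nonadj.
- exact: (insertable_set_indep esym eirr lgP yP).
Qed.

Lemma disjoint_star_leaves : [disjoint I & N].
Proof.
rewrite disjoint_subset; apply/subsetP => x xI; rewrite !inE.
by rewrite indep_star_leaves // in_setU1 eqxx.
Qed.

Definition others := ~: (I :|: N).
Local Notation O := others.

Lemma card_others : #|T| = 2 * k + 2 + #|O|.
Proof.
have := cardsC (I :|: N); rewrite -/others cardsU disjoint_setI0 ?disjoint_star_leaves //.
by rewrite cards0 subn0 card_star_leaves => <-; rewrite -/(deg e y); clear; lia.
Qed.

Definition insertable_degree v := #|[set u in U | e v u]|.

Lemma sum_deg_insertable : \sum_(u in U) deg e u = \sum_(v in N) insertable_degree v + \sum_(v in O) insertable_degree v.
Proof.
have -> : \sum_(u in U) deg e u = \sum_v insertable_degree v.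
  under eq_bigr => u _ do rewrite /deg -sum1dep_card big_mkcond /=.
  rewrite exchange_big /=; apply: eq_bigr => v _.
  rewrite /insertable_degree -sum1dep_card big_mkcondr /=.
  by apply: eq_bigr => u _; rewrite esym.
rewrite (bigID [in I]) /= big1 ?add0n => [|v vI].
  rewrite (bigID [in N]) /=; congr (_ + _); apply: eq_bigl => v.
    rewrite andbC; case: (boolP (v \in N)) => //= vN.
    by rewrite (disjointFl disjoint_star_leaves).
  by rewrite [RHS]in_setC in_setU negb_or.
apply/eqP; rewrite cards_eq0; apply/eqP/setP => u; rewrite !in_set.
by apply/negP => /andP[uU]; rewrite indep_star_leaves // in_setU1 inE uU orbT.
Qed.

(** The two neighbourhoods in [U] share at most one vertex, and their union has at most [k + 1]. *)
Lemma two_insertable_common v1 v2 :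
  (forall a b, a < b -> ins a -> ins b ->
     [&& e v1 (q a), e v1 (q b), e v2 (q a) & e v2 (q b)] = false) ->
  insertable_degree v1 + insertable_degree v2 <= k + 2.
Proof.
move=> two; rewrite /insertable_degree -cardsUI.
have le1 : #|[set u in U | e v1 u] :|: [set u in U | e v2 u]| <= k.+1.
  rewrite -card_insertable_inner; apply: subset_leq_card; apply/subsetP => u.
  by rewrite in_setU !in_set => /orP[] /andP[].
have le2 : #|[set u in U | e v1 u] :&: [set u in U | e v2 u]| <= 1.
  apply/card_le1_eqP => u1 u2; rewrite !in_setI ![_ \in [set _ | _]]in_set.
  case/andP=> /andP[/andP[u1P i1] e11] /andP[_ e21].
  case/andP=> /andP[/andP[u2P i2] e12] /andP[_ e22].
  have [ab|ba|eq] := ltngtP (index u1 P) (index u2 P).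
  - by have := two _ _ ab i1 i2; rewrite !nth_index // e11 e12 e21 e22.
  - by have := two _ _ ba i2 i1; rewrite !nth_index // e11 e12 e21 e22.
  - by rewrite -(nth_index y u1P) eq nth_index.
by rewrite -[k + 2]addSnnS; apply: leq_add.
Qed.

(** Two such neighbours would allow the rerouting whose final piece is empty. *)
Lemma insertable_degree_last : insertable_degree (q p.-1) <= 1.
Proof.
apply/card_le1_eqP => u1 u2; rewrite !in_set.
have aux (a b : nat) : ins a -> ins b -> e (q p.-1) (q a) -> a < b = false.
  move=> ia ib ea; apply/negP => ab; have bp := insertable_lt ib.
  by apply: (@crossing_right _ _ esym P y lgP yP a b p.-1) => //; nlia.
case/andP=> /andP[u1P i1] e1 /andP[/andP[u2P i2] e2].
have [ab|ba|eq] := ltngtP (index u1 P) (index u2 P).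
- by have := aux _ _ i1 i2; rewrite nth_index // ab => /(_ e1).
- by have := aux _ _ i2 i1; rewrite nth_index // ba => /(_ e2).
- by rewrite -(nth_index y u1P) eq nth_index.
Qed.

(** As [q j] is not adjacent to [y], index [j.+1] is not insertable. Two common neighbours in [U]
    thus lie both before, around, or both after this edge of [P], and one of the three crossing
    reroutings applies. *)
Lemma insertable_degree_consecutive j : j.+1 < p -> e y (q j) = false ->
  insertable_degree (q j) + insertable_degree (q j.+1) <= k + 2.
Proof.
move=> jp ej; apply: two_insertable_common => a b ab ia ib; apply/negP.
case/and4P=> ja jb ja' jb'.
have ne c : ins c -> j.+1 != c.
  move=> ic; apply: contraFneq ej => jc; move: ic; rewrite -jc => ic.
  by have := insertable_pred_sym esym ic isT.
have [bj|bj] := leqP b j.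
  by apply: (@crossing_right _ _ esym P y lgP yP a b j) => //; nlia.
have [aj|aj] := leqP a j.
  have := @crossing_between _ _ esym P y lgP yP a b j aj _ ia ib.
  by rewrite jb ja' ltn_neqAle ne // bj => /(_ isT).
have := @crossing_left _ _ esym P y lgP yP a b j _ ab ia ib.
by rewrite ja jb' ltn_neqAle ne // aj => /(_ isT).
Qed.

Hypothesis m3 : 3 <= m.
Hypothesis nostar : forall v, #|[set u in I | e v u]| < m.+2.

(** A neighbour of [y] already has [y] as a leaf, leaving room for [m] more. *)
Lemma insertable_degree_nbr v : v \in N -> insertable_degree v <= m.
Proof.
rewrite in_set => ev; have := nostar v.
rewrite (cardsD1 y) in_set in_setU1 eqxx esym ev add1n !ltnS.
apply: leq_trans; apply: subset_leq_card; apply/subsetP => u.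
rewrite in_set => /andP[uU euv]; rewrite in_setD1 in_set in_setU1 uU orbT euv !andbT.
by apply: contraTneq uU => ->; apply: notin_insertable_set.
Qed.

Lemma insertable_degree_other v : insertable_degree v <= m + 1.
Proof.
have := nostar v; rewrite ltnS -addn1; apply: leq_trans; apply: subset_leq_card.
by apply/subsetP => u; rewrite !in_set => /andP[-> ->]; rewrite orbT.
Qed.

Lemma sum_insertable_degree_nbr (A : {set T}) : A \subset N -> \sum_(v in A) insertable_degree v <= #|A| * m.
Proof.
move=> /subsetP sub; rewrite -sum_nat_const; apply: leq_sum => v /sub.
exact: insertable_degree_nbr.
Qed.

Lemma sum_insertable_degree_others (A : {set T}) : \sum_(v in A) insertable_degree v <= #|A| * (m + 1).
Proof.
by rewrite -sum_nat_const; apply: leq_sum => v _; apply: insertable_degree_other.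
Qed.

Lemma sum_deg_insertable_le : \sum_(u in U) deg e u <= k * m + #|O| * (m + 1).
Proof. by rewrite sum_deg_insertable leq_add ?sum_insertable_degree_nbr ?sum_insertable_degree_others. Qed.

(* The last vertex of [P] outside [I] and [N], if any, is followed by a vertex
   of [N]. *)
Lemma sum_deg_insertable_le_improved : 0 < #|O| ->
  \sum_(u in U) deg e u + 2 * m <= k * m + #|O| * (m + 1) + k + 1 \/
  \sum_(u in U) deg e u + m <= k * m + #|O| * (m + 1).
Proof.
move=> O0; rewrite sum_deg_insertable.
(* One vertex of [O] with at most one neighbour in [U] saves [m] on the crude bound. *)
have small v : v \in O -> insertable_degree v <= 1 ->
    \sum_(v in N) insertable_degree v + \sum_(v in O) insertable_degree v + m <= k * m + #|O| * (m + 1).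
  move=> vO v1; rewrite [\sum_(v in O) _](big_setD1 v) //= (cardsD1 v O) vO.
  have := sum_insertable_degree_nbr (subxx N); have := sum_insertable_degree_others (O :\ v).
  rewrite -/(deg e y) mulnDl mul1n; move: (#|_| * _) (k * m) v1 => A B.
  move: (insertable_degree v) (\sum_(v in N) _) (\sum_(v in _) _); clear; lia.
have [/existsP[v /andP[vO vP]]|noout] := boolP [exists v, (v \in O) && (v \notin P)].
  right; apply: (small v vO); apply: (outside_insertable_le1 esym lgP yP vP).
  by apply: contraTneq vO => ->; rewrite !inE eqxx.
have OP v : v \in O -> v \in P.
  by move=> vO; move/existsPn: noout => /(_ v); rewrite vO /= negbK.
have [v0 v0O] := card_gt0P O0.
have [v vO vmax] := @arg_maxnP T v0 [in O] (fun v => index v P) v0O.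
have vP := OP _ vO; set j := index v P in vmax.
have jp : j < p by rewrite index_mem.
have vq : v = q j by rewrite nth_index.
have [jl|jl] := eqVneq j p.-1.
  by right; apply: (small v vO); rewrite vq jl insertable_degree_last.
have jp1 : j.+1 < p by nlia.
have vN : v \notin N by move: vO; rewrite in_setC in_setU negb_or => /andP[].
have ej : e y (q j) = false by apply/negbTE; rewrite -vq; move: vN; rewrite in_set.
set v' := q j.+1.
have v'P : v' \in P by apply: mem_nth.
have iv' : index v' P = j.+1 by apply: index_uniq.
have v'N : v' \in N.
  have [|v'O] := boolP (v' \in O); first by move/vmax => /=; rewrite iv' ltnn.
  move: v'O; rewrite in_setC negbK in_setU => /orP[|//].
  rewrite in_setU1 => /orP[/eqP v'y|]; first by have := yP; rewrite -v'y v'P.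
  rewrite [v' \in U]in_set v'P /= iv' => ic.
  by have := insertable_pred_sym esym ic isT; rewrite /= ej.
(* The consecutive pair [v], [v'] contributes at most [k + 2] in place of [(m + 1) + m]. *)
left; rewrite [\sum_(v in O) _](big_setD1 v) //= (cardsD1 v O) vO.
rewrite [\sum_(v in N) _](big_setD1 v') //=.
have := insertable_degree_consecutive jp1 ej; rewrite -vq -/v'.
have := sum_insertable_degree_nbr (subsetDl N [set v']); have := sum_insertable_degree_others (O :\ v).
have -> : k = #|N :\ v'|.+1 by rewrite /deg (cardsD1 v' N) v'N.
rewrite (mulSn #|N :\ v'|) mulnDl mul1n; move: (#|_| * (m + 1)) (#|_| * m) => A B.
move: (insertable_degree v) (insertable_degree v') (\sum_(w in N :\ v') _) (\sum_(w in O :\ v) _) #|_|; clear; lia.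
Qed.

Lemma no_star_small : m * d <= #|T| -> #|T| <= 2 * m.
Proof.
move=> dm; rewrite leqNgt; apply/negP => nm.
have nE := card_others.
(* Since the order is [2 * k + 2 + #|O|], [degy] gives [#|O| + 2 <= d]; [w] is the slack, and pairs
   in [U] have degree sum at least [2 * k - w]. *)
have [w dE] : exists w, d = #|O| + 2 + w by exists (d - (#|O| + 2)); move: degy; rewrite nE; lia.
have low : #|U| * (2 * k - w) <= 2 * \sum_(u in U) deg e u.
  apply: sum_pairwise_ge; first by rewrite card_insertable_inner; move: deg0; lia.
  move=> u v uU vU uv.
  have := sig uv; rewrite indep_star_leaves ?in_setU1 ?uU ?vU ?orbT // => /(_ isT).
  by rewrite nE dE; lia.
apply: (@extremal_arith m k #|O| w (\sum_(u in U) deg e u)) => //.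
- by rewrite -nE -dE.
- move: low; rewrite card_insertable_inner addn1 mulnBr; move: (_ * (2 * k)) (_ * w) => A B; lia.
- exact: sum_deg_insertable_le.
- exact: sum_deg_insertable_le_improved.
- by rewrite -nE.
Qed.

End Extremal.

(** * From the degree hypothesis to the conclusion *)

(** The deficiency [n - (deg u + deg v)] is an integer at most [n / m], hence at most its floor. *)
Lemma degree_sum_deficiency (T : finType) (e : rel T) (m : nat) :
  0 < m -> sigma2_ge e (m.-1 * #|T|) m ->
  forall u v, u != v -> ~~ e u v -> #|T| <= deg e u + deg e v + #|T| %/ m.
Proof.
move=> m0 sig u v uv nuv; have := sig u v uv nuv.
have := ltn_ceil #|T| m0; move: (#|T| %/ m) (deg e u + deg e v) => d D.
move: #|T| => n; clear -m0 => lt le; rewrite leqNgt; apply/negP => Dn.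
have : m * (D + d).+1 <= m * n by rewrite leq_mul2l Dn orbT.
have -> : m * n = m.-1 * n + n by case: m m0 {lt le} => // m _; rewrite mulSn addnC.
by rewrite mulnS mulnDr; move: le lt; rewrite mulSn [d * m]mulnC; lia.
Qed.

Theorem theorem3 (t : nat) (T : finType) (e : rel T) :
  5 <= t ->
  simple_graph e ->
  connected e ->
  sigma2_ge e ((t - 3) * #|T|) (t - 2) ->
  ~ (exists s : seq T, hamiltonian_path e s) ->
  2 * t - 4 <= #|T| /\
  (2 * t - 4 < #|T| -> has_induced (@star_rel t) e) /\
  (#|T| = 2 * t - 4 ->
     exists h : rel 'I_(t - 3),
       simple_graph h /\ isomorphic (@join_empty _ 'I_(t - 1) h) e).
Proof.
move=> t5 [esym eirr] con sig noham.
pose m := t - 2; set d := #|T| %/ m.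
have m3 : 3 <= m by rewrite /m; lia.
have em : t - 3 = m.-1 by rewrite /m; lia.
have dm : m * d <= #|T| by rewrite mulnC leq_trunc_div.
have d3 : 3 * d <= #|T| by apply: leq_trans dm; rewrite leq_mul2r m3 orbT.
have {}sig : forall u v, u != v -> ~~ e u v -> #|T| <= deg e u + deg e v + d.
  by apply: degree_sum_deficiency; [lia | rewrite -em].
have [P [y [lgP yP inn degy]]] := exists_inner_big_degree esym eirr con sig d3 noham.
have n0 : 0 < #|T| by apply/card_gt0P; exists y.
have deg0 : 0 < deg e y by move: degy d3 n0; clear; lia.
have nE := card_others esym eirr lgP yP inn deg0.
(* The order is at least [2 * deg e y + 2] and at most [2 * deg e y + d]. *)
have d2 : 2 <= d.
  by move: degy; rewrite nE; clear; lia.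
have le : 2 * m <= #|T| by apply: leq_trans dm; rewrite mulnC leq_mul2l d2 orbT.
have em2 : 2 * t - 4 = 2 * m by rewrite /m; lia.
rewrite em2; split=> //.
have indep := indep_star_leaves esym eirr lgP yP.
split=> [gt|eqn].
  have [/existsP[v vt]|nostar] :=
    boolP [exists v, t <= #|[set u in star_leaves e P y | e v u]|].
    exact: induced_star indep vt.
  exfalso; move: gt; rewrite ltnNge => /negP; apply.
  apply: (no_star_small esym eirr sig lgP yP inn deg0 degy m3 _ dm) => v.
  by move/existsPn: nostar => /(_ v); rewrite -ltnNge (_ : m.+2 = t) // /m; lia.
(* Equality leaves no vertex outside the independent set and the neighbourhood of [y], so
   [deg e y = m.-1]. *)
have d2' : d = 2 by rewrite /d eqn mulnK //; lia.
have k1 : deg e y = m.-1 by move: degy nE; rewrite eqn d2' ; clear -m3; lia.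
have cI := card_star_leaves esym lgP yP inn deg0.
have cC := cardsC (star_leaves e P y).
apply: complete_join (indep) _ => //.
- by move: cC; rewrite cI k1 eqn; rewrite em; clear -m3; lia.
- by rewrite cI k1 /m; lia.
move=> u v uI vI.
have sub : [set w | e u w] \subset ~: star_leaves e P y.
  apply/subsetP => w; rewrite in_set in_setC => euw; apply/negP => wI.
  by rewrite indep in euw.
suff /eqP eqN : [set w | e u w] == ~: star_leaves e P y.
  by have := vI; rewrite -in_setC -eqN in_set.
(* The degree condition with [y] gives [u] as many neighbours as the complement of the independent
   set has vertices, so [u] is joined to all of it. *)
have du : m.-1 <= deg e u.
  have [->|uy] := eqVneq u y; first by rewrite k1.
  have := sig _ _ uy; rewrite (indep _ _ uI (setU11 _ _)) => /(_ isT).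
  by rewrite eqn k1 d2'; clear -m3; lia.
rewrite eqEcard sub /=; apply: leq_trans du.
by move: cC; rewrite cI k1 eqn; clear -m3; lia.
Qed.
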